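(* Let $\mathcal{L}\subset\mathbb{S}^n$ be a regular linear subspace. The following are equivalent: (i) The ML degree of $\mathcal{L}$ is zero. (ii) The restriction $\pi_{L^\perp}|_{L^{-1}}$ of the projection $\pi_{L^\perp}$ is not dominant. (iii) The join of $L^{-1}$ and $L^\perp$ is not the whole space $\mathbb{P}\mathbb{S}^n$. (iv) A generic $K\in\mathcal{L}$ satisfies $(K\mathcal{L}^\perp K)\cap\mathcal{L}\neq\{0\}$. (v) For every pair of bases $\{A_i\}_{i=1}^c$ of $\mathcal{L}^\perp$ and $\{B_k\}_{k=1}^d$ of $\mathcal{L}$, the polynomial $\det(M)\in\mathbb{C}[s_1,\dots,s_d]$ vanishes, where $M$ is the $c\times c$ matrix with entries $M_{ij}=\sum_{k,l=1}^d s_ks_l\,\mathrm{tr}(A_iB_kA_jB_l)$.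
   Context: $\mathbb{S}^n$ denotes the space of complex symmetric $n\times n$ matrices, $\mathbb{P}\mathbb{S}^n$ its projectivization. A linear subspace $\mathcal{L}$ is regular if it contains a full-rank matrix. $\mathcal{L}^\perp=\{\Sigma\in\mathbb{S}^n:\mathrm{tr}(K\Sigma)=0\ \forall K\in\mathcal{L}\}$; $K\mathcal{L}^\perp K=\{K\Sigma K:\Sigma\in\mathcal{L}^\perp\}$. The reciprocal variety $\mathcal{L}^{-1}$ is the Zariski closure of the set of inverses of invertible matrices in $\mathcal{L}$. The ML degree of $\mathcal{L}$ is the number of matrices in $\mathcal{L}^{-1}\cap(\mathcal{L}^\perp+S)$ for generic $S\in\mathbb{S}^n$. $L^{-1},L^\perp$ are the projectivizations. For $S\in\mathbb{P}\mathbb{S}^n$, $L^\perp_S$ is the projective span of $L^\perp$ and $S$. The projection $\pi_{L^\perp}:\mathbb{P}\mathbb{S}^n\dashrightarrow\{W\in\mathrm{Gr}(\dim L^\perp+1,\mathbb{P}\mathbb{S}^n): L^\perp\subset W\}\cong\mathbb{P}^{\dim L}$ sends $S\mapsto L^\perp_S$. *)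

(* Defs.v *)
From mathcomp Require Import all_boot all_algebra.
From mathcomp Require Import Rstruct.
From mathcomp Require Import complex.
From mathcomp Require Import mpoly.

Set Implicit Arguments.
Unset Strict Implicit.
Unset Printing Implicit Defensive.

Import GRing.Theory.
Local Open Scope ring_scope.

Definition CC : numClosedFieldType := complex Rdefinitions.R.

Section Defs.
Variable n : nat.
Local Notation Mat := 'M[CC]_n.

Definition symm (A : Mat) : Prop := A^T = A.

Definition ev (p : {mpoly CC[n * n]}) (A : Mat) : CC :=
  p.@[fun i => mxvec A 0 i].

Definition sym_subspace (L : {vspace Mat}) : Prop :=
  forall K, K \in L -> symm K.

Definition regular (L : {vspace Mat}) : Prop :=
  exists2 K, K \in L & K \in unitmx.

Definition Lperp (L : {vspace Mat}) (S : Mat) : Prop :=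
  symm S /\ forall K, K \in L -> \tr (K *m S) = 0.

(* Zariski closure (in the space of matrices; it stays inside S^n
   for subsets of S^n) *)
Definition zar_closure (X : Mat -> Prop) (S : Mat) : Prop :=
  forall p : {mpoly CC[n * n]}, (forall Y, X Y -> ev p Y = 0) -> ev p S = 0.

(* the reciprocal variety L^{-1} (affine cone) *)
Definition reciprocal (L : {vspace Mat}) (S : Mat) : Prop :=
  zar_closure (fun Y => exists2 K, K \in L & K \in unitmx /\ Y = invmx K) S.

Definition generic_sym (P : Mat -> Prop) : Prop :=
  exists p : {mpoly CC[n * n]},
    (exists S0, symm S0 /\ ev p S0 <> 0) /\
    (forall S, symm S -> ev p S <> 0 -> P S).

Definition generic_in (L : {vspace Mat}) (P : Mat -> Prop) : Prop :=
  exists p : {mpoly CC[n * n]},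
    (exists2 K0, K0 \in L & ev p K0 <> 0) /\
    (forall K, K \in L -> ev p K <> 0 -> P K).

Definition ML_degree_is (L : {vspace Mat}) (d : nat) : Prop :=
  generic_sym (fun S => exists s : seq Mat,
    [/\ uniq s, size s = d &
        forall X, X \in s <-> (reciprocal L X /\ exists2 A, Lperp L A & X = A + S)]).

(* Dominance of pi_{L^perp} restricted to L^{-1}.  The target
   {W in Gr : L^perp subset W} is P(S^n / L^perp); homogeneous polynomial
   functions on S^n / L^perp are the homogeneous polynomials f on S^n
   invariant under translation by L^perp.  The restriction is dominant iff
   no such nonzero f vanishes on (the cone over) L^{-1}. *)
Definition proj_restr_dominant (L : {vspace Mat}) : Prop :=
  ~ exists (f : {mpoly CC[n * n]}) (e : nat),
      [/\ f \is e.-homog,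
          (forall S A, symm S -> Lperp L A -> ev f (S + A) = ev f S),
          (exists S0, symm S0 /\ ev f S0 <> 0) &
          (forall X, reciprocal L X -> ev f X = 0)].

(* affine cone over the join of L^{-1} and L^perp *)
Definition join_cone (L : {vspace Mat}) (S : Mat) : Prop :=
  zar_closure (fun Y => exists X A, [/\ reciprocal L X, Lperp L A & Y = X + A]) S.

Definition basis_perp (L : {vspace Mat}) (c : nat) (A : c.-tuple Mat) : Prop :=
  [/\ free A, (forall i, Lperp L (tnth A i)) &
      (forall S, Lperp L S -> S \in <<A>>%VS)].

Definition Mmat (c d : nat) (A : c.-tuple Mat) (B : d.-tuple Mat)
  : 'M[{mpoly CC[d]}]_c :=
  \matrix_(i < c, j < c)
    \sum_(k < d) \sum_(l < d)
      ('X_k * 'X_l * (\tr (tnth A i *m tnth B k *m tnth A j *m tnth B l))%:MP).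

End Defs.

(* Main.v *)
Require Import Defs.
From HB Require Import structures.
From Stdlib Require Import Classical.
From mathcomp Require Import all_boot all_order all_algebra.
From mathcomp Require Import Rstruct complex mpoly ring.
Set Implicit Arguments.
Unset Strict Implicit.
Unset Printing Implicit Defensive.
Import Order.TTheory GRing.Theory Num.Theory.
Local Open Scope ring_scope.

(* Fix a basis [B_1, ..., B_d] of L. The form [tr] identifies S^n / L^perp with C^d via
   [S |-> (tr (B_k S))_k], so all five conditions concern the rational map
   [K |-> (tr (B_k K^-1))_k] from L to C^d. Since L^{-1} is a cone, it may be replaced by the
   polynomial map [g : K |-> det K ^ 2 * (tr (B_k K^-1))_k]. Conditions (i)-(iii) say that
   the image of [g] lies in a hypersurface, (iv) and (v) that its Jacobian determinant vanishes
   identically: for invertible K, a vector V of L is in the kernel of the differential iff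
   [K^-1 V K^-1] is in L^perp. In characteristic zero the two properties are equivalent by the
   Jacobian criterion. If [f o g = 0] with f of minimal degree, the chain rule gives
   [J * (grad f o g) = 0], and the partial derivatives of f are not all zero. Conversely, each
   coordinate [X_i] is algebraic over C[g] by a dimension count; if the g_k are algebraically
   independent, differentiating separable equations for the [X_i] inverts the Jacobian. *)

(** * Nonvanishing of multivariate polynomials *)

Lemma coef_muni (R : nzRingType) n (p : {mpoly R[n.+1]}) (m : 'X_{1..n.+1}) :
  ((muni p)`_(m ord_max))@_[multinom m (widen_ord (leqnSn n) i) | i < n] = p@_m.
Proof.
rewrite muniE coef_sum linear_sum /= [in RHS](mpolyE p) linear_sum /=.
apply: eq_bigr => m' _; rewrite coefZ coefXn !mcoeffZ mcoeffX.
case: (m' =P m) => [->|/eqP ne]; first by rewrite eqxx mulr1 mcoeffZ mcoeffX eqxx mulr1.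
rewrite mulr0; case: eqP => [eq_max|_]; last by rewrite mulr0 mcoeff0.
rewrite mulr1 mcoeffZ mcoeffX; case: eqP => [/mnmP eq_wid|_]; last by rewrite mulr0.
case/eqP: ne; apply/mnmP => i; case: (unliftP ord_max i) => [j|] -> //.
have := eq_wid j; rewrite !mnmE.
have -> // : widen_ord (leqnSn n) j = lift ord_max j.
by apply/val_inj; rewrite /= /bump leqNgt ltn_ord.
Qed.

Lemma meval_muni (R : comNzRingType) n (p : {mpoly R[n.+1]}) (v : 'I_n.+1 -> R) :
  p.@[v] = (map_poly (meval (fun i => v (widen_ord (leqnSn n) i))) (muni p)).[v ord_max].
Proof.
rewrite mevalE muniE rmorph_sum /= horner_sum; apply: eq_bigr => m _.
rewrite map_polyZ /= map_polyXn hornerZ hornerXn mevalZ mevalX big_ord_recr /= mulrA.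
by congr (_ * _ * _); apply: eq_bigr => i _; rewrite mnmE.
Qed.

(** In characteristic zero the integers below [size p] are distinct, one more than the degree allows
    as roots. *)
Lemma poly_neq0_horner (F : numFieldType) (p : {poly F}) :
  p != 0 -> exists x, p.[x] != 0.
Proof.
move=> p0; have : ~~ all (root p) [seq i%:R | i <- iota 0 (size p)].
  apply/negP => rp; have := max_poly_roots p0 rp.
  rewrite map_inj_uniq ?iota_uniq; last by apply: mulrIn; rewrite oner_eq0.
  by rewrite size_map size_iota ltnn => /(_ isT).
by case/allPn => x _ xP; exists x.
Qed.

(** Induction on the number of variables: some coefficient with respect to the last variable is
    nonzero at a point [v] of the others, so specialising at [v] leaves a nonzero univariate
    polynomial. *)
Lemma mpoly_neq0_meval (F : numFieldType) n (p : {mpoly F[n]}) :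
  p != 0 -> exists v, p.@[v] != 0.
Proof.
elim: n p => [|n IHn] p p0.
  exists (fun=> 0); have : size (msupp p) != 0%N by rewrite size_eq0 -msize_msupp0 msize_poly_eq0.
  apply: contra => /eqP; rewrite (_ : p = (p@_0)%:MP).
    by rewrite mevalC msuppC => ->; rewrite eqxx.
  apply/mpolyP => m; rewrite mcoeffC.
  by rewrite (_ : m = 0%MM) ?eqxx ?mulr1 //; apply/mnmP => -[].
have [m mp] : exists m, m \in msupp p.
  case: (msupp p) (msize_msupp0 p) => [|m s _]; last by exists m; rewrite mem_head.
  by rewrite eqxx msize_poly_eq0 (negPf p0).
have /IHn [v v0] : (muni p)`_(m ord_max) != 0.
  by apply: contraTneq mp => e; rewrite mcoeff_msupp -coef_muni e mcoeff0 eqxx.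
have /poly_neq0_horner [x x0] : map_poly (meval v) (muni p) != 0.
  by apply: contra v0 => /eqP/polyP/(_ (m ord_max)); rewrite coef_map /= coef0 => ->.
exists (fun i => if unlift ord_max i is Some j then v j else x).
rewrite meval_muni unlift_none; apply: contra x0 => /eqP <-; apply/eqP; congr _.[_].
apply: eq_map_poly => q; apply: meval_eq => i.
rewrite (_ : widen_ord _ i = lift ord_max i) ?liftK //.
by apply/val_inj; rewrite /= /bump leqNgt ltn_ord.
Qed.

Lemma mpoly_eq0_meval (F : numFieldType) n (p : {mpoly F[n]}) :
  (forall v, p.@[v] = 0) -> p = 0.
Proof. by move=> p0; apply/eqP/negPn/negP => /mpoly_neq0_meval [v]; rewrite p0 eqxx. Qed.

(** * Partial derivatives and the chain rule *)

Lemma mderiv_prod (R : comNzRingType) n k (F : 'I_n -> {mpoly R[k]}) i :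
  (\prod_l F l)^`M(i) = \sum_j \prod_l (if l == j then (F l)^`M(i) else F l).
Proof.
(* In a list without repetition the test [l == j] singles out one factor, so induction on the list
   goes through. *)
have prodD (s : seq 'I_n) : uniq s -> (\prod_(l <- s) F l)^`M(i) =
    \sum_(j <- s) \prod_(l <- s) (if l == j then (F l)^`M(i) else F l).
  elim: s => [|a s IHs]; first by rewrite !big_nil -mpolyC1 mderivC.
  case/andP=> aNs us; rewrite !big_cons mderivM {}IHs // eqxx; congr (_ * _ + _).
    apply: eq_big_seq => l ls; by case: eqP ls aNs => [-> ->|].
  rewrite mulr_sumr; apply: eq_big_seq => j js; rewrite big_cons.
  by case: eqP js aNs => [-> ->|].
by rewrite prodD ?index_enum_uniq.
Qed.

Lemma mderiv_exp (R : comNzRingType) k (p : {mpoly R[k]}) i e :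
  (p ^+ e)^`M(i) = e%:R *: p ^+ e.-1 * p^`M(i).
Proof.
elim: e => [|e IHe]; first by rewrite expr0 -mpolyC1 mderivC scale0r mul0r.
rewrite exprS mderivM IHe; case: e {IHe} => [|e].
  by rewrite scale0r mul0r mulr0 addr0 expr0 scale1r mulr1 mul1r.
rewrite /= mulrA -scalerAr -exprS [_^`M(i) * _]mulrC -mulrDl; congr (_ * _).
by rewrite -{1}[p ^+ _]scale1r -scalerDl -mulrS.
Qed.

(** Both sides are linear in [p]; on a monomial this is the Leibniz rule for a product of powers. *)
Lemma mderiv_comp (R : comNzRingType) n k (p : {mpoly R[n]}) (g : n.-tuple {mpoly R[k]}) i :
  (p \mPo g)^`M(i) = \sum_j (p^`M(j) \mPo g) * (tnth g j)^`M(i).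
Proof.
elim/mpolyind: p => [|c m p _ _ IHp].
  by rewrite comp_mpoly0 mderiv0 big1 // => j _; rewrite mderiv0 comp_mpoly0 mul0r.
rewrite comp_mpolyD comp_mpolyZ mderivD IHp mderivZ comp_mpolyX mderiv_prod.
rewrite scaler_sumr -big_split; apply: eq_bigr => j _ /=.
rewrite mderivD mderivZ mderivX comp_mpolyD mulrDl; congr (_ + _).
rewrite !comp_mpolyZ comp_mpolyX -!scalerAl; congr (_ *: _).
rewrite [in LHS](bigD1 j) //= eqxx mderiv_exp -scalerAl [in RHS](bigD1 j) //= -scalerAl.
rewrite mnmBE mnm1E eqxx subn1 mulrAC; congr (_ *: (_ * _ * _)).
apply: eq_bigr => l /negPf lj; rewrite lj mnmBE mnm1E.
by rewrite eq_sym lj subn0.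
Qed.

Lemma msize_mderiv_lt (R : nzRingType) n (p : {mpoly R[n]}) i :
  p != 0 -> (msize p^`M(i) < msize p)%N.
Proof.
move=> p0; rewrite (mpolySpred _ p0) ltnS; apply/bigmax_leqP_seq => m.
rewrite mcoeff_msupp mcoeff_mderiv => H _.
have : (m + U_(i))%MM \in msupp p.
  by rewrite mcoeff_msupp; apply: contra H => /eqP ->; rewrite mul0rn.
move/msize_mdeg_lt; rewrite mdegD mdeg1 addn1 => {}H.
by rewrite -ltnS; apply: leq_trans H _; rewrite -mpolySpred.
Qed.

(** The coefficient at [m <> 0] reappears in the derivative by a variable occurring in [m], times a
    positive integer. *)
Lemma mderiv_eq0_const (F : numFieldType) n (p : {mpoly F[n]}) :
  (forall i, p^`M(i) = 0) -> p = (p@_0)%:MP.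
Proof.
move=> dp; apply/mpolyP => m; rewrite mcoeffC.
case: (m =P 0%MM) => [->|/eqP m0]; first by rewrite mulr1.
have [i mi] : exists i, m i != 0%N.
  apply/existsP; apply: contraR m0; rewrite negb_exists => /forallP m0.
  by apply/eqP/mnmP => i; rewrite mnm0E; apply/eqP; rewrite -[_ == _]negbK.
have := mcoeff_mderiv i p (m - U_(i))%MM; rewrite dp mcoeff0 submK; last first.
  by apply/mnm_lepP => j; rewrite mnm1E; case: eqP => // <-; rewrite lt0n.
by move/esym/eqP; rewrite mulrn_eq0 /= => /eqP ->; rewrite mulr0.
Qed.

(** * Jacobian criterion *)

(** Rows are indexed by the variables, so a row vector times this matrix is a directional derivative
    of [g]. *)
Definition jacobian (R : nzRingType) n (g : n.-tuple {mpoly R[n]}) : 'M[{mpoly R[n]}]_n :=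
  \matrix_(i, k) (tnth g k)^`M(i).

(** Strong induction on the size of [f] stands in for minimality: a nonzero partial derivative would
    be a smaller relation. *)
Theorem jacobian_dependent (F : numFieldType) n (g : n.-tuple {mpoly F[n]}) (f : {mpoly F[n]}) :
  f != 0 -> f \mPo g = 0 -> \det (jacobian g) = 0.
Proof.
have [k] := ubnP (msize f); elim: k f => // k IHk f; rewrite ltnS => fk f0 fg.
have [//|f'] := eqVneq (\det (jacobian g)) 0.
have dfg i : f^`M(i) \mPo g = 0.
  pose v : 'cV[{mpoly F[n]}]_n := \col_j (f^`M(j) \mPo g).
  have Jv : jacobian g *m v = 0.
    apply/matrixP => j z; rewrite mxE mxE -[RHS](mderiv0 _ j) -[in RHS]fg mderiv_comp.
    by apply: eq_bigr => l _; rewrite !mxE mulrC.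
  (* The adjugate turns [J v = 0] into [det J * v = 0], and the polynomial ring is a domain. *)
  have : \det (jacobian g) *: v = 0.
    by rewrite -mul_scalar_mx -mul_adj_mx -mulmxA Jv mulmx0.
  by move/matrixP/(_ i 0)/eqP; rewrite !mxE mulf_eq0 (negPf f') => /eqP.
have df i : f^`M(i) = 0.
  apply/eqP/negPn/negP => fi0; case/negP: f'; apply/eqP/(IHk _ _ fi0 (dfg i)).
  exact: leq_trans (msize_mderiv_lt i f0) fk.
move: f0 fg; rewrite (mderiv_eq0_const df) comp_mpolyC => f0 fg.
by rewrite fg eqxx in f0.
Qed.

(** * Algebraic dependence by a dimension count *)

Lemma exists_lin_dep (F : fieldType) (I J : finType) (A : I -> J -> F) :
  (#|J| < #|I|)%N ->
  exists2 c : I -> F, (exists i, c i != 0) & forall j, \sum_i c i * A i j = 0.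
Proof.
move=> ltJI; pose M : 'M[F]_(#|I|, #|J|) := \matrix_(i, j) A (enum_val i) (enum_val j).
have : kermx M != 0.
  rewrite kermx_eq0 -row_leq_rank -ltnNge; exact: leq_ltn_trans (rank_leq_col _) ltJI.
case/rowV0Pn => v /sub_kermxP vM v0; exists (fun i => v 0 (enum_rank i)).
  case/rV0Pn: v0 => i vi; exists (enum_val i); by rewrite enum_valK.
move=> j; have /matrixP/(_ 0 (enum_rank j)) := vM; rewrite !mxE => e.
rewrite -[RHS]e (reindex_onto enum_val enum_rank) /=; last by move=> i _; rewrite enum_rankK.
apply: eq_big => [i|i _]; first by rewrite enum_valK eqxx.
by rewrite mxE enum_valK enum_rankK.
Qed.

Lemma card_bmultinom n b : (#|{: 'X_{1..n < b}}| <= b ^ n)%N.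
Proof.
case: b => [|b].
  by rewrite (_ : #|_| = 0)%N //; apply: eq_card0 => -[].
have lt (m : 'X_{1..n < b.+1}) i : (m i < b.+1)%N.
  apply: leq_ltn_trans (bmdeg m); rewrite mdegE (bigD1 i) //= leq_addr //.
rewrite -[b.+1 in X in (_ <= X)%N]card_ord -[n in X in (_ <= X)%N]card_ord -card_ffun.
apply: (leq_card (fun m : 'X_{1..n < b.+1} => [ffun i => Ordinal (lt m i)])).
move=> m1 m2 /ffunP e; apply/val_inj/mnmP => i.
by have := e i; rewrite !ffunE => -[].
Qed.

Lemma msizeM_leS (R : idomainType) n (p q : {mpoly R[n]}) a b :
  (msize p <= a.+1 -> msize q <= b.+1 -> msize (p * q) <= (a + b).+1)%N.
Proof.
have [->|p0] := eqVneq p 0; first by rewrite mul0r msize0.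
have [->|q0] := eqVneq q 0; first by rewrite mulr0 msize0.
move=> pa qb; rewrite msizeM //.
by have := leq_add pa qb; rewrite addSn addnS; case: (_ + _)%N.
Qed.

Lemma msizeX_leS (R : idomainType) n (p : {mpoly R[n]}) a e :
  (msize p <= a.+1 -> msize (p ^+ e) <= (e * a).+1)%N.
Proof.
move=> pa; elim: e => [|e IHe]; first by rewrite expr0 msizeC oner_eq0.
by rewrite exprS mulSn msizeM_leS.
Qed.

Lemma msize_prod_exp (R : idomainType) n k (g : 'I_k -> {mpoly R[n]}) a N (m : 'I_k -> nat) :
  (forall i, msize (g i) <= a.+1)%N -> (forall i, m i <= N)%N ->
  (msize (\prod_i g i ^+ m i) <= (k * (N * a)).+1)%N.
Proof.
move=> ga mN; rewrite -[k in (k * _)%N]card_ord -sum_nat_const.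
apply: (big_ind2 (fun p b => msize p <= b.+1)%N) => [|p a' q b'|i _].
- by rewrite msizeC oner_eq0.
- exact: msizeM_leS.
- by apply: leq_trans (msizeX_leS _ (ga i)) _; rewrite ltnS leq_mul2r mN orbT.
Qed.

(* There are [N^(n+1)] products [h^e * g^m] with exponents below [N], and they live
   in a space of dimension [O(N^n)]. *)
Lemma algebraic_over_comp (F : fieldType) n (g : n.-tuple {mpoly F[n]}) (h : {mpoly F[n]}) :
  exists2 P : {poly {mpoly F[n]}}, P != 0 & (map_poly (comp_mpoly g) P).[h] = 0.
Proof.
(* [a] bounds all degrees involved, so products with exponents below [N] have size at most
   [b = N * b0]. Since [b0 ^ n < N], the at most [b ^ n] monomials of degree below [b] are fewer
   than the [N ^ n.+1] products. *)
pose a := (msize h + \sum_i msize (tnth g i))%N.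
pose b0 := (a * n.+1).+1; pose N := (b0 ^ n).+1; pose b := (N * b0)%N.
have ha : (msize h <= a.+1)%N by rewrite leqW // leq_addr.
have ga i : (msize (tnth g i) <= a.+1)%N.
  by rewrite leqW // /a (bigD1 i) //= addnCA leq_addr.
pose M (em : 'I_N * {ffun 'I_n -> 'I_N}) := h ^+ em.1 * \prod_i tnth g i ^+ em.2 i.
have sM em : (msize (M em) <= b)%N.
  have /leq_trans -> // : (msize (M em) <= (em.1 * a + n * (N * a)).+1)%N.
    apply: msizeM_leS; first exact: msizeX_leS.
    by apply: msize_prod_exp => // i; apply: ltnW.
  rewrite /b /b0 mulnS mulnS mulnDr -addn1 addnC leq_add //.
  by rewrite leq_add ?leq_mul2r ?(ltnW (ltn_ord _)) ?orbT // mulnC -mulnA.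
have [|c [[e0 m0] c0] cM] := @exists_lin_dep F _ 'X_{1..n < b} (fun em j => (M em)@_j).
  apply: leq_ltn_trans (card_bmultinom _ _) _.
  rewrite card_prod card_ord card_ffun !card_ord /b expnMn mulnC ltn_pmul2r ?expn_gt0 //.
pose Q e := \sum_m c (e, m) *: 'X_[[multinom (m i : nat) | i < n]].
exists (\sum_e Q e *: 'X^e).
  apply: contra c0 => /eqP/polyP/(_ (e0 : nat)); rewrite coef0 coef_sum (bigD1 e0) //=.
  rewrite big1 => [|e ne]; last first.
    by rewrite coefZ coefXn eq_sym (negPf (_ : (e != e0 :> nat))) ?mulr0.
  rewrite addr0 coefZ coefXn eqxx mulr1 => /mpolyP/(_ [multinom (m0 i : nat) | i < n]).
  rewrite mcoeff0 linear_sum (bigD1 m0) //= big1 => [|m ne]; last first.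
    rewrite mcoeffZ mcoeffX; case: eqP => [/mnmP e|]; last by rewrite mulr0.
    by case/eqP: ne; apply/ffunP => i; have := e i; rewrite !mnmE => /val_inj.
  by rewrite addr0 mcoeffZ mcoeffX eqxx mulr1 => ->.
have -> : (map_poly (comp_mpoly g) (\sum_e Q e *: 'X^e)).[h] = \sum_em c em *: M em.
  transitivity (\sum_e \sum_m c (e, m) *: M (e, m)); last first.
    by rewrite pair_bigA; apply: eq_bigr => -[].
  rewrite rmorph_sum /= horner_sum.
  apply: eq_bigr => e _; rewrite map_polyZ /= map_polyXn hornerZ hornerXn.
  rewrite raddf_sum /= mulr_suml; apply: eq_bigr => m _.
  rewrite comp_mpolyZ comp_mpolyX -scalerAl mulrC; congr (_ *: (_ * _)).
  by apply: eq_bigr => i _; rewrite mnmE.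
apply/mpolyP => m; rewrite mcoeff0 linear_sum /=.
(* The relation [cM] covers the monomials of degree below [b]; higher ones occur in no product. *)
have [lt_mb|le_bm] := ltnP (mdeg m) b.
  by rewrite -[RHS](cM (BMultinom lt_mb)); apply: eq_bigr => em _; rewrite mcoeffZ.
rewrite big1 // => em _; rewrite mcoeffZ memN_msupp_eq0 ?mulr0 //.
by apply: msize_mdeg_ge; apply: leq_trans le_bm.
Qed.

(** Descent on the size of an annihilator: if its derivative also kills [h], either the derivative
    is a smaller annihilator, or it is zero and the annihilator is a constant, which independence
    forces to vanish. *)
Lemma separable_annihilator (F : numFieldType) n (g : n.-tuple {mpoly F[n]}) (h : {mpoly F[n]}) :
  (forall f, f \mPo g = 0 -> f = 0) ->
  exists2 P : {poly {mpoly F[n]}},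
    (map_poly (comp_mpoly g) P).[h] = 0 & (map_poly (comp_mpoly g) P^`()).[h] != 0.
Proof.
move=> inj; have [P] := algebraic_over_comp g h.
have [k] := ubnP (size P); elim: k P => // k IHk P; rewrite ltnS => Pk P0 Ph.
have [dPh|] := eqVneq (map_poly (comp_mpoly g) P^`()).[h] 0; last by exists P.
have [dP0|dP0] := eqVneq P^`() 0; last first.
  by apply: IHk dP0 dPh; apply: leq_trans (lt_size_deriv P0) Pk.
have PC : P = (P`_0)%:P.
  apply: size1_polyC; rewrite leqNgt; apply/negP => P1.
  have /polyP/(_ (size P).-2) := dP0; rewrite coef_deriv coef0 prednK ?ltn_predRL //.
  rewrite -lead_coefE => /eqP; rewrite -mulr_natr mulf_eq0 lead_coef_eq0 (negPf P0) /=.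
  have -> : ((size P).-1)%:R = ((size P).-1)%:R%:MP :> {mpoly F[n]} by rewrite rmorph_nat.
  by rewrite mpolyC_eq0 pnatr_eq0 -[_ == _]negbK -lt0n ltn_predRL P1.
move: Ph P0; rewrite PC map_polyC hornerC => /inj ->.
by rewrite polyC0 eqxx.
Qed.

(** The [E k] come from differentiating the coefficients of [P]. They do not depend on [j], which
    lets them form a matrix multiplying the Jacobian. *)
Lemma mderiv_horner_comp (R : comNzRingType) n (g : n.-tuple {mpoly R[n]}) (h : {mpoly R[n]})
    (P : {poly {mpoly R[n]}}) :
  exists E : 'I_n -> {mpoly R[n]}, forall j,
    ((map_poly (comp_mpoly g) P).[h])^`M(j) =
    (map_poly (comp_mpoly g) P^`()).[h] * h^`M(j) + \sum_k E k * (tnth g k)^`M(j).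
Proof.
elim/poly_ind: P => [|P c [E IHE]].
  exists (fun=> 0) => j; rewrite deriv0 !rmorph0 horner0 mderiv0 mul0r add0r.
  by rewrite big1 // => k _; rewrite mul0r.
exists (fun k => E k * h + (c^`M(k) \mPo g)) => j.
rewrite derivD derivM derivX derivC addr0 mulr1 !rmorphD !rmorphM /= map_polyX map_polyC /=.
rewrite !hornerD !hornerM !hornerX !hornerC !mderivD mderivM IHE mderiv_comp.
have -> : \sum_k (E k * h + (c^`M(k) \mPo g)) * (tnth g k)^`M(j) =
    (\sum_k E k * (tnth g k)^`M(j)) * h + \sum_k (c^`M(k) \mPo g) * (tnth g k)^`M(j).
  by rewrite mulr_suml -big_split; apply: eq_bigr => k _; rewrite /= mulrDl [_ * h * _]mulrAC.
ring.
Qed.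

Theorem jacobian_independent (F : numFieldType) n (g : n.-tuple {mpoly F[n]}) :
  (forall f, f \mPo g = 0 -> f = 0) -> \det (jacobian g) != 0.
Proof.
move=> inj.
have /fin_all_exists [P PP] : forall i, exists Q : {poly {mpoly F[n]}},
    (map_poly (comp_mpoly g) Q).['X_i] = 0 /\ (map_poly (comp_mpoly g) Q^`()).['X_i] != 0.
  by move=> i; have [Q] := separable_annihilator 'X_i inj; exists Q.
have [E EP] := fin_all_exists (fun i => mderiv_horner_comp g 'X_i (P i)).
pose D : 'rV[{mpoly F[n]}]_n := \row_i (- (map_poly (comp_mpoly g) (P i)^`()).['X_i]).
(* The partial derivatives of ['X_i] are Kronecker deltas, so the differentiated equations form a
   matrix identity with diagonal right-hand side, nonsingular by separability. *)
have ED : (\matrix_(i, k) E i k) *m (jacobian g)^T = diag_mx D.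
  apply/matrixP => i j; rewrite !mxE; have := EP i j; rewrite (PP i).1 mderiv0 mderivX mnmE.
  move/esym/eqP; rewrite addrC addr_eq0 => /eqP e.
  transitivity (\sum_k E i k * (tnth g k)^`M(j)); first by apply: eq_bigr => k _; rewrite !mxE.
  rewrite e; case: eqP => [->|_]; last by rewrite scale0r mulr0 oppr0 mulr0n.
  have -> : (U_(j) - U_(j))%MM = 0%MM :> 'X_{1..n} by apply/mnmP => k; rewrite !mnmE subnn.
  by rewrite scale1r mpolyX0 mulr1 mulr1n.
apply: contraNneq (_ : \det (diag_mx D) != 0) => [J0|].
  by rewrite -ED det_mulmx det_tr J0 mulr0.
rewrite det_diag; apply/prodf_neq0 => i _; by rewrite mxE oppr_eq0 (PP i).2.
Qed.

(** * Differential of the inverse on a linear pencil *)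

Lemma mderiv_mulmx (R : comNzRingType) d m n p (A : 'M[{mpoly R[d]}]_(m, n))
    (B : 'M[{mpoly R[d]}]_(n, p)) i :
  map_mx (mderiv i) (A *m B) = map_mx (mderiv i) A *m B + A *m map_mx (mderiv i) B.
Proof.
apply/matrixP => a b; rewrite !mxE raddf_sum -big_split; apply: eq_bigr => j _.
by rewrite !mxE /= mderivM.
Qed.

(** Jacobi's formula: differentiate one row at a time and expand along that row. *)
Lemma mderiv_det (R : comNzRingType) d n (M : 'M[{mpoly R[d]}]_n) i :
  (\det M)^`M(i) = \tr (\adj M *m map_mx (mderiv i) M).
Proof.
pose N r : 'M_n := \matrix_(a, b) if a == r then (M a b)^`M(i) else M a b.
transitivity (\sum_r \det (N r)).
  rewrite /determinant raddf_sum exchange_big /=; apply: eq_bigr => s _.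
  rewrite -[(-1) ^+ _](rmorph_sign (@mpolyC d R)) mderiv_mulC mderiv_prod mulr_sumr.
  by apply: eq_bigr => r _; congr (_ * _); apply: eq_bigr => l _; rewrite mxE.
rewrite mxtrace_mulC; apply: eq_bigr => r _; rewrite (expand_det_row _ r) mxE.
apply: eq_bigr => j _; rewrite !mxE eqxx; congr (_ * _); rewrite /cofactor; congr (_ * \det _).
by apply/matrixP => a b; rewrite !mxE eq_sym (negPf (neq_lift _ _)).
Qed.

(* On invertible matrices this is [det M ^ 2 *: M^-1]: a polynomial parametrisation of
   the cone over the inverses. With the exponent 1 instead of 2 the differential would
   degenerate for 1 x 1 matrices. *)
Definition invcone (R : comNzRingType) n (M : 'M[R]_n) : 'M[R]_n := \det M *: \adj M.

Lemma map_invcone (R S : comNzRingType) (f : {rmorphism R -> S}) n (M : 'M[R]_n) :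
  map_mx f (invcone M) = invcone (map_mx f M).
Proof. by rewrite /invcone map_mxZ map_mx_adj det_map_mx. Qed.

Lemma invconeE (F : fieldType) n (M : 'M[F]_n) :
  M \in unitmx -> invcone M = \det M ^+ 2 *: invmx M.
Proof.
by move=> uM; rewrite /invcone /invmx uM scalerA expr2 mulfK // -unitfE -unitmxE.
Qed.

(** [2 * m] is never 1. This is where the exponent 2 in [invcone] enters. *)
Lemma mulrn_double_fix (F : numDomainType) (x : F) m : x = x *+ (2 * m) -> x = 0.
Proof.
case: m => [|m]; first by rewrite muln0.
move/esym/eqP; rewrite mulnS add2n mulrS -subr_eq0 addrAC subrr add0r.
by rewrite mulrn_eq0 => /eqP.
Qed.

Section Pencil.
Variables (F : numFieldType) (n d : nat) (B : d.-tuple 'M[F]_n).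

Definition lincomb (v : 'I_d -> F) : 'M[F]_n := \sum_i v i *: tnth B i.

Definition pencil : 'M[{mpoly F[d]}]_n :=
  \sum_i 'X_i *: map_mx (@mpolyC d F) (tnth B i).

(** The map [g] of the opening comment, in the coordinates given by [B]. *)
Definition traces : d.-tuple {mpoly F[d]} :=
  [tuple \tr (map_mx (@mpolyC d F) (tnth B k) *m invcone pencil) | k < d].

Lemma map_mpolyCK v m p (A : 'M[F]_(m, p)) : map_mx (meval v) (map_mx (@mpolyC d F) A) = A.
Proof. by apply/matrixP => i j; rewrite !mxE mevalC. Qed.

Lemma meval_pencil v : map_mx (meval v) pencil = lincomb v.
Proof.
rewrite map_mx_sum; apply: eq_bigr => i _.
by rewrite map_mxZ map_mpolyCK /= mevalXU.
Qed.

Lemma meval_traces v k :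
  (tnth traces k).@[v] = \tr (tnth B k *m invcone (lincomb v)).
Proof.
by rewrite tnth_mktuple -trace_map_mx map_mxM map_mpolyCK map_invcone meval_pencil.
Qed.

Lemma mderiv_pencil i : map_mx (mderiv i) pencil = map_mx (@mpolyC d F) (tnth B i).
Proof.
rewrite map_mx_sum (bigD1 i) //= big1 => [|j ne]; last first.
  apply/matrixP => a b; rewrite !mxE mulrC mderiv_mulC mderivX mnm1E (negPf ne).
  by rewrite scale0r mulr0.
apply/matrixP => a b; rewrite !mxE mulrC mderiv_mulC mderivX mnm1E eqxx addr0 scale1r.
have -> : (U_(i) - U_(i))%MM = 0%MM :> 'X_{1..d} by apply/mnmP => k; rewrite !mnmE subnn.
by rewrite mpolyX0 mulr1.
Qed.

(** Differentiate [K * invcone K = (det K) ^ 2] in the direction of [B_i], using Jacobi's formula on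
    the right. *)
Lemma invcone_derivative v i (D := map_mx (meval v) (map_mx (mderiv i) (invcone pencil)))
    (K := lincomb v) :
  tnth B i *m invcone K + K *m D = (\det K * \tr (\adj K *m tnth B i) *+ 2)%:M.
Proof.
have e : pencil *m invcone pencil = (\det pencil ^+ 2)%:M.
  by rewrite -scalemxAr mul_mx_adj scale_scalar_mx expr2.
have := congr1 (map_mx (meval v)) (mderiv_mulmx pencil (invcone pencil) i).
rewrite e mderiv_pencil map_mxD !map_mxM map_mpolyCK map_invcone meval_pencil => <-.
apply/matrixP => a b; rewrite !mxE mderivMn mevalMn; congr (_ *+ _).
rewrite mderiv_exp mderiv_det mderiv_pencil expr1 -scalerAl mevalZ mevalM.
rewrite -trace_map_mx -det_map_mx map_mxM map_mx_adj meval_pencil map_mpolyCK.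
by rewrite mulr_natl.
Qed.

(** In the direction [W], the derivative of [invcone] at [K] is [- (det K) ^ 2 * K^-1 W K^-1] plus a
    scalar multiple of [K^-1]. In both directions of the equivalence a trace computation shows that
    the scalar vanishes. *)
Lemma jacobian_traces v (K := lincomb v) : K \in unitmx ->
  (\det (jacobian traces)).@[v] = 0 <->
  exists2 w : 'rV[F]_d, w != 0 &
    forall k, \tr (tnth B k *m (invmx K *m lincomb (w 0) *m invmx K)) = 0.
Proof.
move=> uK; pose D i := map_mx (meval v) (map_mx (mderiv i) (invcone pencil)).
have q0 : \det K != 0 by rewrite -unitfE -unitmxE.
have JE : map_mx (meval v) (jacobian traces) = \matrix_(i, k) \tr (tnth B k *m D i).
  apply/matrixP => i k; rewrite !mxE tnth_mktuple.
  have -> : (\tr (map_mx (mpolyC d (R:=F)) (tnth B k) *m invcone pencil))^`M(i) =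
     \tr (map_mx (mderiv i) (map_mx (mpolyC d (R:=F)) (tnth B k) *m invcone pencil)).
    by rewrite /mxtrace raddf_sum; apply: eq_bigr => a _; rewrite [RHS]mxE.
  rewrite mderiv_mulmx -trace_map_mx map_mxD !map_mxM map_mpolyCK.
  rewrite (_ : map_mx (mderiv i) (map_mx _ _) = 0) ?map_mx0 ?mul0mx ?add0r //.
  by apply/matrixP => a b; rewrite !mxE mderivC.
have DE (w : 'rV_d) (W := lincomb (w 0)) (Dw := \sum_i w 0 i *: D i) :
    W *m invcone K + K *m Dw = (\det K * \tr (\adj K *m W) *+ 2)%:M.
  rewrite mulmx_suml mulmx_sumr -big_split /=.
  under eq_bigr do rewrite -scalemxAl -[K *m (_ *: _)]scalemxAr -scalerDr invcone_derivative.
  transitivity ((\sum_i w 0 i * (\det K * \tr (\adj K *m tnth B i) *+ 2))%:M : 'M_n).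
    by rewrite raddf_sum; apply: eq_bigr => i _; rewrite /= scale_scalar_mx.
  congr _%:M; rewrite mulmx_sumr raddf_sum mulr_sumr -sumrMnl; apply: eq_bigr => i _.
  by rewrite -scalemxAr /= mxtraceZ mulrnAr mulrCA.
have DJ (w : 'rV_d) (Dw := \sum_i w 0 i *: D i) :
    w *m map_mx (meval v) (jacobian traces) = \row_k \tr (tnth B k *m Dw).
  apply/rowP => k; rewrite JE !mxE mulmx_sumr raddf_sum; apply: eq_bigr => i _.
  by rewrite mxE -scalemxAr /= mxtraceZ.
split=> [/eqP|[w w0 wB]].
  rewrite -det_map_mx => /det0P [w w0]; rewrite DJ => /rowP wJ; exists w => // k.
  have {}wJ j : \tr (tnth B j *m \sum_i w 0 i *: D i) = 0 by have := wJ j; rewrite !mxE.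
  have /= := DE w; set Dw := \sum_i _ in wJ *; set W := lincomb (w 0) => KD.
  (* [K] is itself a combination of the [B_i], so the kernel condition applies to it. *)
  have KDw : \tr (K *m Dw) = 0.
    rewrite mulmx_suml raddf_sum big1 // => i _.
    by rewrite -scalemxAl /= mxtraceZ wJ mulr0.
  have t0 : \det K * \tr (\adj K *m W) = 0.
    have := congr1 mxtrace KD; rewrite mxtraceD KDw addr0 mxtrace_scalar.
    rewrite -scalemxAr mxtraceZ mxtrace_mulC -mulrnA.
    exact: mulrn_double_fix.
  have {}KD : invmx K *m W *m invmx K = - (\det K ^- 2 *: Dw).
    move: KD; rewrite t0 mul0rn raddf0 invconeE // -scalemxAr => /eqP.
    rewrite addr_eq0 => /eqP/(congr1 (mulmx (invmx K))).
    rewrite mulmxN mulKmx // -scalemxAr mulmxA => e.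
    by rewrite -scalerN -e scalerA mulVf ?scale1r // expf_neq0.
  by rewrite KD mulmxN -scalemxAr raddfN /= mxtraceZ wJ mulr0 oppr0.
apply/eqP; rewrite -det_map_mx; apply/det0P; exists w => //; rewrite DJ.
apply/rowP => k; rewrite !mxE.
have /= := DE w; set Dw := \sum_i _; set W := lincomb (w 0) in wB *.
have -> : \tr (\adj K *m W) = 0.
  have -> : \tr (\adj K *m W) = \det K * \tr (invmx K *m W).
    by rewrite /invmx uK -scalemxAl mxtraceZ mulrA mulfV ?mul1r.
  have -> : invmx K *m W = invmx K *m W *m invmx K *m K by rewrite mulmxKV.
  rewrite mxtrace_mulC mulmx_suml raddf_sum big1 ?mulr0 // => i _.
  by rewrite -scalemxAl /= mxtraceZ wB mulr0.
rewrite mulr0 mul0rn raddf0 invconeE // -scalemxAr => /eqP.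
rewrite addrC addr_eq0 => /eqP/(congr1 (mulmx (invmx K))).
rewrite mulKmx // => ->.
by rewrite !mulmxN -!scalemxAr raddfN /= mxtraceZ [invmx K *m _]mulmxA wB mulr0 oppr0.
Qed.
End Pencil.

(** * Orthogonal complement *)

Lemma mxvec_dot (R : comNzRingType) m n (A B : 'M[R]_(m, n)) :
  \sum_i mxvec A 0 i * mxvec B 0 i = \tr (A *m B^T).
Proof.
rewrite (reindex _ (curry_mxvec_bij m n)) /=.
transitivity (\sum_i \sum_j A i j * B i j).
  by rewrite pair_bigA; apply: eq_bigr => -[i j] _; rewrite /= !mxvecE.
by apply: eq_bigr => i _; rewrite mxE; apply: eq_bigr => j _; rewrite mxE.
Qed.

Section LinComb.
Variables (F : numFieldType) (n d : nat) (B : d.-tuple 'M[F]_n).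

Lemma lincomb_eq0 v : free B -> lincomb B v = 0 -> forall i, v i = 0.
Proof.
move=> /freeP fB e; apply: fB; rewrite -[RHS]e; apply: eq_bigr => i _.
by rewrite (tnth_nth 0).
Qed.

Lemma lincomb_mem (U : {vspace 'M[F]_n}) v :
  (forall i, tnth B i \in U) -> lincomb B v \in U.
Proof. by move=> BU; apply: memv_suml => i _; apply: memvZ. Qed.

Lemma span_lincomb M : M \in <<B>>%VS -> exists v, M = lincomb B v.
Proof.
move=> /coord_span e; exists (fun i => coord B i M); rewrite [LHS]e.
by apply: eq_bigr => i _; rewrite (tnth_nth 0).
Qed.

(** A right inverse of the matrix with rows [mxvec (B_k)] gives a dual family; since the [B_j] are
    symmetric, symmetrising it does not change the traces. *)
Lemma dual_family : free B -> (forall k, (tnth B k)^T = tnth B k) ->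
  exists S : 'I_d -> 'M[F]_n, (forall k, (S k)^T = S k) /\
    (forall j k, \tr (tnth B j *m S k) = (j == k)%:R).
Proof.
move=> fB sB; pose N : 'M[F]_(d, n * n) := \matrix_k mxvec (tnth B k).
have frN : row_free N.
  apply: inj_row_free => v vN; apply/rowP => k; rewrite mxE; apply: lincomb_eq0 k => //.
  apply: (can_inj mxvecK); rewrite linear0 linear_sum -[RHS]vN mulmx_sum_row.
  by apply: eq_bigr => k _; rewrite linearZ rowK.
pose T k : 'M[F]_n := vec_mx (row k (pinvmx N)^T).
have BT j k : \tr (tnth B j *m (T k)^T) = (j == k)%:R.
  have /matrixP/(_ j k) := mulmxVp frN; rewrite -mxvec_dot vec_mxK [X in _ = X -> _]mxE => <-.
  by rewrite mxE; apply: eq_bigr => i _; rewrite !mxE.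
exists (fun k => 2^-1 *: (T k + (T k)^T)); split=> [k|j k].
  by rewrite linearZ linearD /= trmxK addrC.
have BT' : \tr (tnth B j *m T k) = (j == k)%:R.
  by rewrite -mxtrace_tr trmx_mul sB mxtrace_mulC BT.
rewrite -scalemxAr mxtraceZ mulmxDr mxtraceD BT BT' -mulr2n -(mulr_natl (j == k)%:R 2).
by rewrite mulKf // pnatr_eq0.
Qed.

End LinComb.

(** When [B] spans [L] the kernel is [Lperp L], the second component testing symmetry. It turns the
    predicate [Lperp] into a subspace, which has a basis. *)
Definition perp_map (F : fieldType) n d (B : d.-tuple 'M[F]_n) (S : 'M[F]_n) :
  'rV[F]_d * 'M[F]_n := (\row_k \tr (tnth B k *m S), S - S^T).

Lemma perp_map_is_linear (F : fieldType) n d (B : d.-tuple 'M[F]_n) : linear (perp_map B).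
Proof.
move=> a S T; congr (_, _).
  by apply/rowP => k; rewrite !mxE mulmxDr -scalemxAr mxtraceD mxtraceZ.
by rewrite /= linearD linearZ opprD scalerBr addrACA.
Qed.

HB.instance Definition _ (F : fieldType) n d (B : d.-tuple 'M[F]_n) :=
  GRing.isLinear.Build F 'M[F]_n ('rV[F]_d * 'M[F]_n)%type _ (perp_map B)
    (perp_map_is_linear B).

Section Perp.
Variables (n d : nat) (L : {vspace 'M[CC]_n}) (B : d.-tuple 'M[CC]_n).
Hypotheses (sL : sym_subspace L) (bB : basis_of L B).

Let BL i : tnth B i \in L.
Proof. by apply: (basis_mem bB); rewrite mem_tnth. Qed.

Let sB i : (tnth B i)^T = tnth B i.
Proof. exact: sL. Qed.

Lemma mem_lincomb v : lincomb B v \in L.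
Proof. exact: lincomb_mem. Qed.

Lemma mem_lincombP K : K \in L -> exists v, K = lincomb B v.
Proof. by rewrite -(span_basis bB) => /span_lincomb. Qed.

Lemma LperpP S : symm S -> (forall k, \tr (tnth B k *m S) = 0) -> Lperp L S.
Proof.
move=> sS BS; split=> // K /mem_lincombP [v ->].
by rewrite mulmx_suml raddf_sum big1 // => i _; rewrite -scalemxAl /= mxtraceZ BS mulr0.
Qed.

Lemma exists_basis_perp : exists c (A : c.-tuple 'M[CC]_n), basis_perp L A.
Proof.
pose U := lker (linfun (perp_map B)).
have UP S : S \in U <-> Lperp L S.
  rewrite memv_ker lfunE /=; split=> [/eqP [/rowP BS /eqP]|[sS BS]].
    by rewrite subr_eq0 => /eqP sS; apply: LperpP => [|k]; [|have := BS k; rewrite !mxE].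
  apply/eqP; congr (_, _); last by rewrite sS subrr.
  by apply/rowP => k; rewrite !mxE BS.
exists (\dim U), (vbasis U); split; first exact: (basis_free (vbasisP U)).
  by move=> i; apply/UP/vbasis_mem/mem_tnth.
by move=> S /UP; rewrite (span_basis (vbasisP U)).
Qed.

(** If [Y] were outside [L], then [Y] followed by [B] would be free, and its dual family would
    contain an element of [Lperp L] of trace 1 against [Y]. *)
Lemma perp_perp Y : symm Y -> (forall S, Lperp L S -> \tr (Y *m S) = 0) -> Y \in L.
Proof.
move=> sY YS; apply: contraT => YL.
have fYB : free (cons_tuple Y B).
  by rewrite free_cons (span_basis bB) YL (basis_free bB).
have [|S [sS BS]] := dual_family fYB.
  by move=> k; case: (unliftP 0 k) => [j|] ->; rewrite ?tnthS ?tnth0.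
have : \tr (Y *m S 0) = 0.
  apply: YS; apply: LperpP => // k; have := BS (lift 0 k) 0; by rewrite tnthS.
by have := BS 0 0; rewrite tnth0 => -> /eqP; rewrite oner_eq0.
Qed.

End Perp.

(** * Polynomial functions of a matrix and the reciprocal variety *)

(** Serves to separate homogeneous components by scaling. *)
Lemma poly_sum_eq0 (F : numFieldType) N (a : 'I_N -> F) :
  (forall t, t != 0 -> \sum_(e < N) t ^+ e * a e = 0) -> forall e, a e = 0.
Proof.
move=> ta e; pose r := \sum_(i < N) a i *: 'X^i.
(* The factor ['X] takes care of [t = 0], where nothing is assumed. *)
have r0 : 'X * r = 0.
  apply/eqP/negPn/negP => /poly_neq0_horner [t]; rewrite hornerM hornerX.
  have [->|t0] := eqVneq t 0; first by rewrite mul0r eqxx.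
  rewrite [r.[t]](_ : _ = 0) ?mulr0 ?eqxx // -[RHS](ta t t0) horner_sum.
  by apply: eq_bigr => i _; rewrite hornerZ hornerXn mulrC.
have /polyP/(_ e.+1) := r0; rewrite coefXM coef0 coef_sum (bigD1 e) //= big1 => [|i ne].
  by rewrite coefZ coefXn eqxx mulr1 addr0.
by rewrite coefZ coefXn eq_sym (negPf (_ : i != e :> nat)) ?mulr0.
Qed.

Lemma meval_dhomog (R : comNzRingType) n (p : {mpoly R[n]}) e t v :
  p \is e.-homog -> p.@[fun i => t * v i] = t ^+ e * p.@[v].
Proof.
move/dhomogP => hp; rewrite !mevalE mulr_sumr; apply: eq_big_seq => m /hp <-.
rewrite /= mdegE -prodrXr mulrCA; congr (_ * _).
by rewrite -big_split; apply: eq_bigr => i _; rewrite exprMn.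
Qed.

Section Ev.
Variable n : nat.
Implicit Types (p : {mpoly CC[n * n]}) (A S : 'M[CC]_n).

Lemma ev_scale p t A :
  ev p (t *: A) = \sum_(e < msize p) t ^+ e * ev (pihomog mdeg e p) A.
Proof.
rewrite /ev {1}(pihomog_partitionE (leqnn (msize p))) raddf_sum; apply: eq_bigr => e _ /=.
rewrite -(meval_dhomog _ _ (pihomogP _ _ _)); apply: meval_eq => i.
by rewrite linearZ mxE.
Qed.

Definition subst_mx d p (M : 'M[{mpoly CC[d]}]_n) : {mpoly CC[d]} :=
  p \mPo [tuple mxvec M 0 i | i < n * n].

Lemma meval_subst_mx d p (M : 'M[{mpoly CC[d]}]_n) v :
  (subst_mx p M).@[v] = ev p (map_mx (meval v) M).
Proof.
rewrite comp_mpoly_meval; apply: meval_eq => i.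
by rewrite tnth_mktuple -map_mxvec mxE.
Qed.

Definition generic_mx : 'M[{mpoly CC[n * n]}]_n := vec_mx (\row_i 'X_i).

Lemma ev_generic_mx A : map_mx (meval (fun i => mxvec A 0 i)) generic_mx = A.
Proof.
apply: (can_inj mxvecK); apply/rowP => i.
by rewrite -map_mxvec vec_mxK !mxE mevalXU.
Qed.

Lemma ev_subst_mx p (M : 'M[{mpoly CC[n * n]}]_n) A :
  ev (subst_mx p M) A = ev p (map_mx (meval (fun i => mxvec A 0 i)) M).
Proof. exact: meval_subst_mx. Qed.

Lemma ev_det_generic A : ev (\det generic_mx) A = \det A.
Proof. by rewrite /ev -det_map_mx ev_generic_mx. Qed.

Lemma ev_trace_generic A S :
  ev (\tr (map_mx (@mpolyC (n * n) CC) A *m generic_mx)) S = \tr (A *m S).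
Proof. by rewrite /ev -trace_map_mx map_mxM ev_generic_mx map_mpolyCK. Qed.

End Ev.

Section Reciprocal.
Variables (n : nat) (L : {vspace 'M[CC]_n}).
Hypothesis sL : sym_subspace L.

Lemma reciprocal_inv K : K \in L -> K \in unitmx -> reciprocal L (invmx K).
Proof. by move=> KL uK p; apply; exists K. Qed.

(** Scaling maps inverses to inverses and pulls polynomials back to polynomials, so it preserves the
    closure. *)
Lemma reciprocalZ t X : t != 0 -> reciprocal L X -> reciprocal L (t *: X).
Proof.
move=> t0 rX p pL.
have e Y : ev (subst_mx p (t%:MP *: generic_mx n)) Y = ev p (t *: Y).
  by rewrite ev_subst_mx map_mxZ ev_generic_mx /= mevalC.
rewrite -e; apply: rX => _ [K KL [uK ->]]; rewrite e; apply: pL.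
exists (t^-1 *: K); first exact: memvZ.
by rewrite unitmxZ ?unitfE ?invr_eq0 // invmxZ ?unitmxZ ?unitfE ?invr_eq0 // invrK.
Qed.

(** Symmetry is given by linear equations that hold on inverses, hence on the closure. *)
Lemma reciprocal_symm X : reciprocal L X -> symm X.
Proof.
move=> rX; apply/matrixP => i j; rewrite mxE; apply/eqP; rewrite -subr_eq0.
have e Y : ev (generic_mx n j i - generic_mx n i j) Y = Y j i - Y i j.
  by rewrite -{2 3}(ev_generic_mx Y) !mxE -mevalB.
rewrite -e; apply/eqP/rX => _ [K KL [uK ->]]; rewrite e.
have sK : (invmx K)^T = invmx K by rewrite trmx_inv sL.
by rewrite -[in X in X - _]sK mxE subrr.
Qed.

(* The exponent [2 * n - 1] in [invcone (c *: K) = c ^ (2 * n - 1) *: invcone K] is positive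
   unless [n = 0]. *)
Lemma invmx_invcone K : K \in L -> K \in unitmx ->
  exists2 K', K' \in L & invcone K' = invmx K.
Proof.
move=> KL uK; have q0 : \det K != 0 by rewrite -unitfE -unitmxE.
have [n0|n0] := posnP n.
  by exists K => //; apply/matrixP => i; have := ltn_ord i; rewrite [X in (_ < X)%N]n0.
pose c : CC := (2 * n).-1.-root (\det K ^- 2).
have N0 : (0 < (2 * n).-1)%N by rewrite -subn1 subn_gt0 (leq_ltn_trans n0) // ltn_Pmull.
have cE : c ^+ (2 * n).-1 = \det K ^- 2 by rewrite rootCK.
have c0 : c != 0.
  have : c ^+ (2 * n).-1 != 0 by rewrite cE invr_eq0 expf_neq0.
  by rewrite expf_eq0 N0.
exists (c *: K); first exact: memvZ.
rewrite invconeE ?unitmxZ ?unitfE // invmxZ ?unitmxZ ?unitfE // detZ scalerA.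
rewrite exprMn -exprM mulnC -[(2 * n)%N]prednK ?muln_gt0 // exprSr cE.
by rewrite mulrAC mulfK // mulVf ?scale1r ?expf_neq0.
Qed.

End Reciprocal.

(** * The implications *)

Lemma LperpD n (L : {vspace 'M[CC]_n}) S T : Lperp L S -> Lperp L T -> Lperp L (S + T).
Proof.
move=> [sS S0] [sT T0]; split; first by rewrite /symm linearD /= sS sT.
by move=> K KL; rewrite mulmxDr mxtraceD S0 // T0 // addr0.
Qed.

Lemma LperpN n (L : {vspace 'M[CC]_n}) S : Lperp L S -> Lperp L (- S).
Proof.
move=> [sS S0]; split; first by rewrite /symm linearN /= sS.
by move=> K KL; rewrite mulmxN raddfN /= S0 // oppr0.
Qed.

Lemma trace_dual_sum (R : comNzRingType) n d (B T : 'I_d -> 'M[R]_n) (y : 'I_d -> R) j :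
  (forall j k, \tr (B j *m T k) = (j == k)%:R) ->
  \tr (B j *m \sum_k y k *: T k) = y j.
Proof.
move=> BT; rewrite mulmx_sumr [LHS](raddf_sum (mxtrace (n := n))) /=.
rewrite (bigD1 j) //= big1 => [|k ne].
  by rewrite -scalemxAr mxtraceZ BT eqxx mulr1 addr0.
by rewrite -scalemxAr mxtraceZ BT eq_sym (negPf ne) mulr0.
Qed.

(** The [T k] span a complement of [Lperp L] in the symmetric matrices, and the sum is the
    projection onto it along [Lperp L]: a linear section of the quotient. *)
Lemma exists_section n (L : {vspace 'M[CC]_n}) (B : (\dim L).-tuple 'M[CC]_n) :
  sym_subspace L -> basis_of L B ->
  exists T : 'I_(\dim L) -> 'M[CC]_n,
    [/\ forall k, symm (T k), forall j k, \tr (tnth B j *m T k) = (j == k)%:R &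
        forall S, symm S -> Lperp L (S - \sum_k \tr (tnth B k *m S) *: T k)].
Proof.
move=> sL bB; have BL i : tnth B i \in L by apply: (basis_mem bB); rewrite mem_tnth.
have [k|T [sT BT]] := dual_family (basis_free bB); first exact: sL.
exists T; split=> // S sS; apply: (LperpP bB) => [|j].
  rewrite /symm linearB linear_sum /= sS; congr (_ - _).
  by apply: eq_bigr => k _; rewrite linearZ /= sT.
by rewrite mulmxBr raddfB /= (trace_dual_sum (B := tnth B)) // subrr.
Qed.

Section Implications.
Variables (n : nat) (L : {vspace 'M[CC]_n}).
Hypotheses (sL : sym_subspace L) (rL : regular L).
Let B := vbasis L.
Let bB : basis_of L B := vbasisP L.
Let BL i : tnth B i \in L. Proof. exact/vbasis_mem/mem_tnth. Qed.

Lemma trace_perp k S A : Lperp L A -> \tr (tnth B k *m (S + A)) = \tr (tnth B k *m S).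
Proof. by move=> [_ A0]; rewrite mulmxDr mxtraceD A0 // addr0. Qed.

(** [f] evaluates the genericity polynomial [p] at the representative modulo [Lperp L] lying in the
    translate of the section through [S0]. It is thus invariant, with [f S0 = p S0] nonzero. *)
Lemma ML_degree0_not_dominant : ML_degree_is L 0 -> ~ proj_restr_dominant L.
Proof.
move=> [p [[S0 [sS0 pS0]] pS]]; apply.
have [T [sT BT pT]] := exists_section sL bB.
pose sec S := \sum_k \tr (tnth B k *m S) *: T k.
pose C := S0 - sec S0.
pose f := subst_mx p (\sum_k \tr (map_mx (@mpolyC _ CC) (tnth B k) *m generic_mx n) *:
  map_mx (@mpolyC _ CC) (T k) + map_mx (@mpolyC _ CC) C).
have fE S : ev f S = ev p (sec S + C).
  rewrite ev_subst_mx map_mxD map_mpolyCK map_mx_sum; congr (ev p (_ + C)).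
  by apply: eq_bigr => k _; rewrite map_mxZ map_mpolyCK -ev_trace_generic.
have f_inv S A : Lperp L A -> ev f (S + A) = ev f S.
  by move=> pA; rewrite !fE /sec; under eq_bigr do rewrite trace_perp //.
(* Otherwise [sec X + C] would be a generic datum congruent to [X] modulo [Lperp L], with [X] as a
   solution. *)
have f_rec X : reciprocal L X -> ev f X = 0.
  move=> rX; apply/eqP/negPn/negP; rewrite fE => /eqP fX.
  have sX := reciprocal_symm sL rX.
  have pC := pT _ sS0; have pX := pT _ sX.
  have sS : symm (sec X + C).
    have -> : sec X + C = X + (C - (X - sec X)).
      by rewrite opprB [RHS]addrC -addrA subrK addrC.
    rewrite /symm linearD /= sX; congr (_ + _).
    by have [] : Lperp L (C - (X - sec X)) by apply: LperpD => //; apply: LperpN.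
  have [s [_ /size0nil -> /(_ X) [_]]] := pS _ sS fX.
  have H : reciprocal L X /\ exists2 A, Lperp L A & X = A + (sec X + C).
    split=> //; exists ((X - sec X) - C); last first.
      by rewrite [sec X + C]addrC addrA !subrK.
    by apply: LperpD => //; apply: LperpN.
  by move/(_ H).
have /eqP : ev f S0 != 0 by rewrite fE /C addrC subrK; apply/eqP.
(* Some homogeneous component of [f] is nonzero at [S0]; it inherits the other properties because
   [Lperp L] and the reciprocal variety are stable under nonzero scaling. *)
rewrite -[S0]scale1r ev_scale => fS0.
have [e fe] : exists e : 'I_(msize f), ev (pihomog mdeg e f) S0 != 0.
  apply/existsP; apply: contra_notT fS0; rewrite negb_exists => /forallP fe.
  by rewrite big1 // => e _; rewrite (eqP (negbNE (fe e))) mulr0.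
exists (pihomog mdeg e f), e; split; first exact: pihomogP.
- move=> S A sS pA; apply/eqP; rewrite -subr_eq0; apply/eqP; move: e {fe}.
  apply: poly_sum_eq0 => t t0; under eq_bigr do rewrite mulrBr.
  rewrite sumrB -!ev_scale scalerDr f_inv ?subrr //.
  case: pA => sA A0; split; first by rewrite /symm linearZ /= sA.
  by move=> K KL; rewrite -scalemxAr mxtraceZ A0 // mulr0.
- by exists S0; split=> //; apply/eqP.
- move=> X rX; move: e {fe}; apply: poly_sum_eq0 => t t0; rewrite -ev_scale.
  by apply: f_rec; apply: reciprocalZ.
Qed.

(** By invariance [f] vanishes on all sums [X + A], hence on their closure, but not at [S0]. *)
Lemma not_dominant_join : ~ proj_restr_dominant L -> exists S, symm S /\ ~ join_cone L S.
Proof.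
move/NNPP => [f [e [_ f_inv [S0 [sS0 fS0]] f_rec]]]; exists S0; split=> // jS0.
apply/fS0/jS0 => _ [X [A [rX pA ->]]].
by rewrite f_inv ?f_rec //; apply: reciprocal_symm rX.
Qed.

Lemma exists_regular_coord : exists v, lincomb B v \in unitmx.
Proof. by have [K /(mem_lincombP bB) [v ->] uK] := rL; exists v. Qed.

Lemma det_pencil v : (\det (pencil B)).@[v] = \det (lincomb B v).
Proof. by rewrite -det_map_mx meval_pencil. Qed.

(** [f] times the determinant of the pencil vanishes everywhere, and that determinant is nonzero by
    regularity. *)
Lemma mpoly_eq0_regular (f : {mpoly CC[\dim L]}) :
  (forall v, lincomb B v \in unitmx -> f.@[v] = 0) -> f = 0.
Proof.
move=> fv; have : f * \det (pencil B) = 0.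
  apply: mpoly_eq0_meval => v; rewrite mevalM det_pencil.
  have [->|q0] := eqVneq (\det (lincomb B v)) 0; first by rewrite mulr0.
  by rewrite fv ?mul0r // unitmxE unitfE.
move/eqP; rewrite mulf_eq0 => /orP [/eqP //|/eqP q0].
have [v] := exists_regular_coord.
by rewrite unitmxE unitfE -det_pencil q0 meval0 eqxx.
Qed.

(** A polynomial separating [S] from the join, restricted to the translate of the section through
    [S], is a nontrivial relation between the [traces]. *)
Lemma join_jacobian S : symm S -> ~ join_cone L S -> \det (jacobian (traces B)) = 0.
Proof.
move=> sS0 jS; have [p pP] := not_all_ex_not _ _ jS.
have [p_join pS0] := imply_to_and _ _ pP.
have [T [sT BT pT]] := exists_section sL bB.
pose sec S := \sum_k \tr (tnth B k *m S) *: T k.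
pose C := S - sec S.
pose f := subst_mx p (\sum_k 'X_k *: map_mx (@mpolyC (\dim L) CC) (T k) +
  map_mx (@mpolyC _ CC) C).
have fE v : f.@[v] = ev p (\sum_k v k *: T k + C).
  rewrite meval_subst_mx map_mxD map_mpolyCK map_mx_sum; congr (ev p (_ + C)).
  by apply: eq_bigr => k _; rewrite map_mxZ map_mpolyCK /= mevalXU.
apply: (@jacobian_dependent _ _ _ f).
  apply: contra_notN pS0 => /eqP f0; have := fE (fun k => \tr (tnth B k *m S)).
  by rewrite f0 meval0 /C addrC subrK.
apply: mpoly_eq0_regular => v uK; rewrite comp_mpoly_meval fE.
set K := lincomb B v in uK *; have q0 : \det K != 0 by rewrite -unitfE -unitmxE.
have -> : \sum_k (tnth (traces B) k).@[v] *: T k = sec (invcone K).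
  by apply: eq_bigr => k _; rewrite meval_traces.
have rK : reciprocal L (invcone K).
  rewrite invconeE //; apply: reciprocalZ; first by rewrite expf_neq0.
  exact: reciprocal_inv (mem_lincomb bB v) uK.
have sK := reciprocal_symm sL rK.
apply: p_join; exists (invcone K), (C - (invcone K - sec (invcone K))); split=> //.
  by apply: LperpD; [apply: pT|apply/LperpN/pT].
by rewrite opprB [RHS]addrC -addrA subrK addrC.
Qed.

Lemma jacobian_generic : \det (jacobian (traces B)) = 0 ->
  generic_in L (fun K => exists X, [/\ X \in L, X <> 0 &
    exists2 S, Lperp L S & X = K *m S *m K]).
Proof.
(* Generic here means invertible. *)
move=> J0; exists (\det (generic_mx n)); split.
  have [K KL uK] := rL; exists K => //; apply/eqP.
  by rewrite ev_det_generic -unitfE -unitmxE.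
move=> K KL; rewrite ev_det_generic => /eqP; rewrite -unitfE -unitmxE => uK.
have [v Kv] := mem_lincombP bB KL; rewrite Kv in uK *.
have [] := jacobian_traces uK; rewrite J0 meval0 => /(_ erefl) [w w0 Bw] _.
exists (lincomb B (w 0)); split; first exact: (mem_lincomb bB).
  move=> /(lincomb_eq0 (basis_free bB)) w0'; case/eqP: w0.
  by apply/rowP => i; rewrite w0' mxE.
exists (invmx (lincomb B v) *m lincomb B (w 0) *m invmx (lincomb B v)).
  apply: (LperpP bB) => //; rewrite /symm !trmx_mul trmx_inv.
  by rewrite !sL ?mulmxA //; apply: (mem_lincomb bB).
by rewrite -mulmxA mulmxKV // mulmxA mulmxV // mul1mx.
Qed.

Lemma meval_Mmat c d (A : c.-tuple 'M[CC]_n) (B' : d.-tuple 'M[CC]_n) v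
    (K := lincomb B' v) :
  map_mx (meval v) (Mmat A B') = \matrix_(i, j) \tr (tnth A i *m K *m tnth A j *m K).
Proof.
apply/matrixP => i j; rewrite !mxE raddf_sum /=.
rewrite [tnth A i *m K]mulmx_sumr !mulmx_suml (raddf_sum (mxtrace (n := n))) /=.
apply: eq_bigr => k _.
rewrite raddf_sum mulmx_sumr (raddf_sum (mxtrace (n := n))) /=; apply: eq_bigr => l _.
rewrite !mevalM !mevalXU mevalC -scalemxAr mxtraceZ -scalemxAr -!scalemxAl mxtraceZ.
by rewrite mulrA [v l * v k]mulrC.
Qed.

(** At generic [K], the coordinates of [S] in [A] form a kernel vector of the evaluated matrix,
    because [tr (A_i K S K) = tr (A_i X) = 0]. *)
Lemma generic_det (c d : nat) (A : c.-tuple 'M[CC]_n) (B' : d.-tuple 'M[CC]_n) :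
  generic_in L (fun K => exists X, [/\ X \in L, X <> 0 &
    exists2 S, Lperp L S & X = K *m S *m K]) ->
  basis_perp L A -> basis_of L B' -> \det (Mmat A B') = 0.
Proof.
move=> [p [[K0 K0L pK0] pK]] [fA AL spanA] bB'.
(* The factor [p], nonzero on [L], absorbs the nongeneric points. *)
have : \det (Mmat A B') * subst_mx p (pencil B') = 0.
  apply: mpoly_eq0_meval => v; rewrite mevalM meval_subst_mx meval_pencil.
  have [->|/eqP pv] := eqVneq (ev p (lincomb B' v)) 0; first by rewrite mulr0.
  have [X [XL X0 [S pS XE]]] := pK _ (mem_lincomb bB' v) pv.
  have [x Sx] := span_lincomb (spanA _ pS).
  rewrite -det_map_mx meval_Mmat -det_tr; move: (lincomb B' v) XE => K XE.
  set M := \matrix_(_, _) _; suff /eqP -> : \det M^T == 0 by rewrite mul0r.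
  apply/det0P; exists (\row_i x i).
    apply: contra_notN X0 => /eqP/rowP x0; rewrite XE Sx /lincomb big1 ?mulmx0 ?mul0mx //.
    by move=> i _; have := x0 i; rewrite !mxE => ->; rewrite scale0r.
  apply/rowP => i; rewrite !mxE -[RHS](proj2 (AL i) _ XL) XE Sx mxtrace_mulC.
  rewrite !mulmxA mulmx_sumr !mulmx_suml (raddf_sum (mxtrace (n := n))) /=.
  by apply: eq_bigr => j _; rewrite !mxE -scalemxAr -scalemxAl /= mxtraceZ.
move/eqP; rewrite mulf_eq0 => /orP [/eqP //|/eqP q0].
have [v Kv] := mem_lincombP bB' K0L; case: pK0.
by rewrite Kv -meval_pencil -meval_subst_mx q0 meval0.
Qed.

(** A kernel vector of [M] at [K] gives [S] in [Lperp L] with [K S K] orthogonal to [Lperp L], hence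
    in [L]; its coordinates are a kernel vector of the Jacobian. *)
Lemma det_jacobian c (A : c.-tuple 'M[CC]_n) :
  basis_perp L A -> \det (Mmat A B) = 0 -> \det (jacobian (traces B)) = 0.
Proof.
move=> [fA AL spanA] M0; apply: mpoly_eq0_regular => v uK; apply/(jacobian_traces uK).
set K := lincomb B v in uK *; have sK : K^T = K by apply/sL/(mem_lincomb bB).
have /eqP : (\det (Mmat A B)).@[v] = 0 by rewrite M0 meval0.
rewrite -det_map_mx meval_Mmat => /det0P [x x0 /rowP xM].
pose S := lincomb A (x 0); pose Y := K *m S *m K.
have SE : invmx K *m Y *m invmx K = S.
  by rewrite /Y -!mulmxA mulmxV // mulmx1 mulKmx.
have pS : Lperp L S.
  split; first by rewrite /symm linear_sum; apply: eq_bigr => i _; rewrite linearZ /= (AL i).1.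
  move=> K' K'L; rewrite mulmx_sumr raddf_sum big1 // => i _.
  by rewrite -scalemxAr /= mxtraceZ (AL i).2 // mulr0.
have YL : Y \in L.
  apply: (perp_perp sL bB); first by rewrite /symm !trmx_mul sK (proj1 pS) mulmxA.
  move=> T /spanA/span_lincomb [y ->]; rewrite mulmx_sumr raddf_sum big1 // => j _.
  rewrite -scalemxAr /= mxtraceZ; apply/eqP; rewrite mulf_eq0; apply/orP; right.
  have := xM j; rewrite !mxE => <-; apply/eqP.
  rewrite /Y -2!mulmxA mxtrace_mulC !mulmx_suml (raddf_sum (mxtrace (n := n))) /=.
  by apply: eq_bigr => i _; rewrite !mxE -!scalemxAl /= mxtraceZ.
have [w Yw] := mem_lincombP bB YL; exists (\row_i w i).
  apply: contra x0 => /eqP/rowP w0; apply/eqP/rowP => i; rewrite mxE.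
  apply: (lincomb_eq0 fA); rewrite -/S -SE Yw /lincomb big1 ?mulmx0 ?mul0mx // => j _.
  by have := w0 j; rewrite !mxE => ->; rewrite scale0r.
move=> k; have -> : lincomb B ((\row_i w i) 0) = Y.
  by rewrite Yw; apply: eq_bigr => i _; rewrite mxE.
by rewrite SE (proj2 pS).
Qed.

(** A relation [f] between the [traces] yields [p], which is invariant under [Lperp L] and vanishes
    on the reciprocal variety. A solution [X] for [S] would give [p S = p X = 0]. *)
Lemma jacobian_ML_degree0 : \det (jacobian (traces B)) = 0 -> ML_degree_is L 0.
Proof.
move=> J0.
have [f [f0 ft]] : exists f, f != 0 /\ f \mPo traces B = 0.
  apply: NNPP => nf; have := jacobian_independent (g := traces B); rewrite J0 eqxx.
  move=> /(_ _)/notF; apply=> f ft; apply/eqP/negPn/negP => f0.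
  by apply: nf; exists f.
have [T [sT BT pT]] := exists_section sL bB.
pose p := f \mPo [tuple \tr (map_mx (@mpolyC (n * n) CC) (tnth B k) *m generic_mx n) | k < \dim L].
have pE S : ev p S = f.@[fun k => \tr (tnth B k *m S)].
  rewrite /ev comp_mpoly_meval; apply: meval_eq => k.
  by rewrite tnth_mktuple; apply: ev_trace_generic.
exists p; split.
  have [y fy] := mpoly_neq0_meval f0; exists (\sum_k y k *: T k); split.
    by rewrite /symm linear_sum; apply: eq_bigr => k _; rewrite linearZ /= sT.
  rewrite pE; apply/eqP; apply: contra fy => /eqP <-; apply/eqP/meval_eq => j.
  by rewrite (trace_dual_sum (B := tnth B)).
move=> S sS pS; exists [::]; split=> // X; split=> // -[rX [A pA XE]]; case: pS.
have <- : ev p X = ev p S.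
  by rewrite !pE; apply: meval_eq => k; rewrite XE addrC trace_perp.
(* Every inverse is a value of [invcone] on [L], where [p] becomes [f] composed with [traces]. *)
apply: rX => _ [K KL [uK ->]]; have [K' K'L <-] := invmx_invcone KL uK.
have [v ->] := mem_lincombP bB K'L; rewrite pE.
have := congr1 (meval v) ft; rewrite meval0 comp_mpoly_meval => <-.
by apply: meval_eq => k; rewrite meval_traces.
Qed.

End Implications.

Theorem theorem6p1 (n : nat) (L : {vspace 'M[CC]_n}) :
  sym_subspace L -> regular L ->
  [<-> ML_degree_is L 0;
       ~ proj_restr_dominant L;
       (exists S : 'M[CC]_n, symm S /\ ~ join_cone L S);
       generic_in L (fun K => exists X, [/\ X \in L, X <> 0 &
                       exists2 S, Lperp L S & X = K *m S *m K]);
       (forall (c d : nat) (A : c.-tuple 'M[CC]_n) (B : d.-tuple 'M[CC]_n),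
          basis_perp L A -> basis_of L B -> \det (Mmat A B) = 0)].
Proof.
move=> sL rL; tfae.
- exact: ML_degree0_not_dominant.
- exact: not_dominant_join.
- by move=> [S [sS jS]]; apply: jacobian_generic => //; apply: join_jacobian jS.
- by move=> gL c d A B; apply: generic_det gL.
- move=> M0; apply: jacobian_ML_degree0 => //.
  (* One pair of bases suffices to close the cycle, and one exists. *)
  have [c [A bA]] := exists_basis_perp (vbasisP L).
  by apply: (det_jacobian sL rL bA); apply: M0 (vbasisP L).
Qed.
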